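(* Let $\sigma = \textrm{Prop} \cup \mathbb{A}$ be a modal signature with $\mathbb{A} = \{R_i \mid i \in I\}$, $I$ finite. If $M_a$ and $N_b$ are degree-finite $\sigma$-LTSs, then $M_a$ and $N_b$ satisfy the same sentences of $\textrm{HL}^B(\downarrow,@)$ over $\sigma$ if and only if $\textrm{hom}_{\mathbb{N}}(\mathcal{C}_\sigma,M_a) = \textrm{hom}_{\mathbb{N}}(\mathcal{C}_\sigma,N_b)$.
   Context: A $\sigma$-LTS is a structure over a modal signature $\sigma$ (finitely many unary proposition letters and binary actions $R_i$) with one distinguished element; degree-finite means each state has finitely many successors and predecessors. The hybrid logic $\textrm{HL}(\downarrow,@)$ (without nominals) extends basic modal logic with world variables $x$, the binder $\downarrow x.\varphi$ (bind $x$ to the current state) and $@_x\varphi$ (evaluate $\varphi$ at the state assigned to $x$). $\textrm{HL}^B(\downarrow,@)$ is its extension with backward modalities $\Diamond^{-,\geq 1}_i$ (a ''black diamond'' in the paper), where $M,a\models \Diamond^{-,\geq 1}_i\varphi$ iff some $b$ with $R_i^M(b,a)$ satisfies $\varphi$. $\mathcal{C}_\sigma$ is the class of finite connected $\sigma$-LTSs (connected via undirected paths of binary facts). $\textrm{hom}_{\mathbb{N}}(\mathcal{C},M_a)$ is the vector indexed by $\mathcal{C}$ whose entry at $T_c$ is the number of homomorphisms from $T_c$ to $M_a$ mapping $c$ to $a$. *)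

(* Defs.v *)
From HB Require Import structures.
From Stdlib Require Import Relation_Operators.
From mathcomp Require Import all_boot finmap.
From mathcomp Require Import boolp classical_sets functions cardinality.

Set Implicit Arguments.
Unset Strict Implicit.
Unset Printing Implicit Defensive.

Local Open Scope classical_set_scope.

Record modal_signature := ModalSignature {
  prop_letter : finType;
  action : finType }.

Record LTS (sigma : modal_signature) := MkLTS {
  state :> Type;
  val_ : prop_letter sigma -> state -> Prop;
  rel_ : action sigma -> state -> state -> Prop;
  point : state }.

Arguments val_ {sigma} M p s : rename.
Arguments rel_ {sigma} M i s t : rename.
Arguments point {sigma} M : rename.

Definition degree_finite (sigma : modal_signature) (M : LTS sigma) : Prop :=
  forall s : M,
    finite_set [set t : M | exists i, rel_ M i s t] /\
    finite_set [set t : M | exists i, rel_ M i t s].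

Definition adjacent (sigma : modal_signature) (M : LTS sigma) (s t : M) : Prop :=
  exists i, rel_ M i s t \/ rel_ M i t s.

Definition connected (sigma : modal_signature) (M : LTS sigma) : Prop :=
  forall s t : M, clos_refl_trans M (@adjacent sigma M) s t.

Definition finite_connected (sigma : modal_signature) (M : LTS sigma) : Prop :=
  finite_set [set: M] /\ connected M.

Definition is_hom (sigma : modal_signature) (T M : LTS sigma) (h : T -> M) : Prop :=
  [/\ forall p s, val_ T p s -> val_ M p (h s),
      forall i s t, rel_ T i s t -> rel_ M i (h s) (h t) &
      h (point T) = point M].

(* [fset_set] needs a choiceType, hence the type alias [{classic _}]. *)
Definition homs (sigma : modal_signature) (T M : LTS sigma) :
    set {classic (T -> M)} :=
  [set h | is_hom h].
Arguments homs {sigma} T M.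

(* [fset_set] of an infinite set is empty, so this is the number of
   homomorphisms only if [homs T M] is finite; see [finite_homs]. *)
Definition hom_count (sigma : modal_signature) (T M : LTS sigma) : nat :=
  #|` fset_set (homs T M)|.

Definition hom_vector (sigma : modal_signature) (C : LTS sigma -> Prop)
    (M : LTS sigma) : {T : LTS sigma | C T} -> nat :=
  fun T => hom_count (sval T) M.
Arguments hom_vector {sigma} C M.

(* HL^B(down, @) without nominals; the world variables are the natural
   numbers. Disjunction and the box modalities are definable. *)
Inductive formula (sigma : modal_signature) : Type :=
| Top
| Letter of prop_letter sigma
| WVar of nat
| Neg of formula sigma
| And of formula sigma & formula sigma
| Dia of action sigma & formula sigma
| BDia of action sigma & formula sigma
| Down of nat & formula sigma
| At of nat & formula sigma.

Arguments Top {sigma}.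
Arguments WVar {sigma}.

Fixpoint free_vars (sigma : modal_signature) (phi : formula sigma) : seq nat :=
  match phi with
  | Top => [::]
  | Letter _ => [::]
  | WVar x => [:: x]
  | Neg psi => free_vars psi
  | And psi chi => free_vars psi ++ free_vars chi
  | Dia _ psi => free_vars psi
  | BDia _ psi => free_vars psi
  | Down x psi => [seq y <- free_vars psi | y != x]
  | At x psi => x :: free_vars psi
  end.

Definition sentence (sigma : modal_signature) (phi : formula sigma) : Prop :=
  free_vars phi = [::].

Definition update (X : Type) (g : nat -> X) (x : nat) (a : X) : nat -> X :=
  fun y => if y == x then a else g y.

Fixpoint sat (sigma : modal_signature) (M : LTS sigma) (g : nat -> M) (s : M)
    (phi : formula sigma) : Prop :=
  match phi with
  | Top => True
  | Letter p => val_ M p s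
  | WVar x => g x = s
  | Neg psi => ~ sat g s psi
  | And psi chi => sat g s psi /\ sat g s chi
  | Dia i psi => exists t : M, rel_ M i s t /\ sat g t psi
  | BDia i psi => exists t : M, rel_ M i t s /\ sat g t psi
  | Down x psi => sat (update g x s) s psi
  | At x psi => sat g (g x) psi
  end.

(* For a sentence the assignment is irrelevant; see [models_sentence]. *)
Definition models (sigma : modal_signature) (M : LTS sigma)
    (phi : formula sigma) : Prop :=
  forall g : nat -> M, sat g (point M) phi.

Lemma sat_ext (sigma : modal_signature) (M : LTS sigma) (phi : formula sigma)
    (g g' : nat -> M) (s : M) :
  {in free_vars phi, g =1 g'} -> (sat g s phi <-> sat g' s phi).
Proof.
elim: phi g g' s => [|p|x|psi IH|psi IH1 chi IH2|i psi IH|i psi IH|x psi IH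
  |x psi IH] //= g g' s e.
- by rewrite e ?mem_head.
- by split=> h /(IH g g' s e).
- have e1 : {in free_vars psi, g =1 g'} by move=> y hy; apply: e; rewrite mem_cat hy.
  have e2 : {in free_vars chi, g =1 g'} by move=> y hy; apply: e; rewrite mem_cat hy orbT.
  by split=> -[/(IH1 g g' s e1) ? /(IH2 g g' s e2) ?].
- by split=> -[t [? /(IH g g' t e) ?]]; exists t.
- by split=> -[t [? /(IH g g' t e) ?]]; exists t.
- apply: IH => y hy; rewrite /update; case: eqVneq => // yx.
  by apply: e; rewrite mem_filter yx.
- by rewrite e ?mem_head //; apply: IH => y hy; apply: e; rewrite inE hy orbT.
Qed.

Lemma models_sentence (sigma : modal_signature) (M : LTS sigma)
    (phi : formula sigma) (g : nat -> M) :
  sentence phi -> (models M phi <-> sat g (point M) phi).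
Proof.
move=> phi0; split=> [|h g']; first exact.
by apply: (iffLR (sat_ext _ _)) h => x; rewrite phi0.
Qed.

Lemma finite_hom_images (sigma : modal_signature) (T M : LTS sigma) (s : T) :
  connected T -> degree_finite M ->
  finite_set [set h s | h in [set h : T -> M | is_hom h]].
Proof.
move=> cT dM.
have : finite_set [set h (point T) | h in [set h : T -> M | is_hom h]].
  apply: sub_finite_set (finite_set1 (point M)) => _ [h [_ _ hpt] <-].
  exact: hpt.
elim: (cT (point T) s) => // {s} [s t [i st] fs|s t u _ IH1 _ IH2 /IH1/IH2 //].
apply: sub_finite_set
  (bigcup_finite (F := fun x => [set y | exists i, rel_ M i x y] `|`
                                [set y | exists i, rel_ M i y x]) fs _).
  move=> _ [h hh <-]; exists (h s); first by exists h.
  have [_ hR _] := hh.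
  by case: st => /hR ?; [left|right]; exists i.
by move=> x _; rewrite finite_setU; exact: dM.
Qed.

Lemma finite_homs (sigma : modal_signature) (T M : LTS sigma) :
  finite_connected T -> degree_finite M -> finite_set (homs T M).
Proof.
move=> [fT cT] dM.
have /finite_seqP[l lE] : finite_set [set: {classic T}] by [].
pose e (h : {classic (T -> M)}) : seq M := [seq h s | s <- l : seq T].
have inje : {in homs T M &, injective e}.
  move=> h h' _ _; rewrite /e => /(iffRL (@eq_in_map {classic T} M h h' l)) ehh'.
  apply: (functional_extensionality_dep (A := T)) => s; apply: ehh'.
  by have : [set: {classic T}] s by []; rewrite lE.
rewrite -(eq_finite_set (inj_card_eq inje)).
rewrite {inje lE}/e; elim: l => [|s l IHl] /=.
  by apply: sub_finite_set (finite_set1 [::]) => _ [h _ <-].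
apply: sub_finite_set
  (finite_image2 cons (finite_hom_images s cT dM) IHl) => _ [h hh <-] /=.
by exists (h s); [exists h|exists [seq h x | x <- l]; [exists h|]].
Qed.

(* Main.v *)
(** If the two structures satisfy the same sentences, degree-finiteness and a
    Hennessy-Milner argument let one name, along paths from the point, any
    finite set of reachable states of [M] by world variables and match it with
    states of [N] so that all formulas agree. The matching is a partial
    isomorphism; applied to the union of the images of all homomorphisms
    [T -> M] it turns these injectively into homomorphisms [T -> N].

    Conversely, sorting the homomorphisms from [T] by their kernels expresses
    the hom counts as sums of counts of injective homomorphisms from quotients
    of [T]. By induction on the size of [T], the counts of injective
    homomorphisms from finite connected structures agree. Hence the balls of
    radius [n] around the two points embed into each other, so they are
    isomorphic, being finite, and a sentence of modal depth [n] only depends on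
    that ball. *)

From Stdlib Require Import Relation_Operators Operators_Properties.
From mathcomp Require Import all_boot finmap.
From mathcomp Require Import boolp classical_sets functions cardinality.
Require Import Defs.

Set Implicit Arguments.
Unset Strict Implicit.
Unset Printing Implicit Defensive.

Local Open Scope classical_set_scope.

(** * Preliminaries on comparing cardinalities and on connectedness *)

Lemma leq_card_fset_set_in (U V : choiceType) (A : set U) (B : set V)
    (f : U -> V) :
  finite_set A -> finite_set B -> {in A &, injective f} ->
  (forall x, A x -> B (f x)) -> #|` fset_set A| <= #|` fset_set B|.
Proof.
move=> fA fB injf AB; have cfA := inj_card_eq injf.
have ffA : finite_set (f @` A) by rewrite (eq_finite_set cfA).
rewrite -((fcard_eq ffA fA) cfA); apply: fsubset_leq_card.
by rewrite -fset_set_sub// => _ [x Ax <-]; exact: AB.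
Qed.

Lemma connected_of_point (sigma : modal_signature) (T : LTS sigma) :
  (forall t : T, clos_refl_trans T (@adjacent sigma T) (point T) t) ->
  connected T.
Proof.
move=> cT s t; apply: rt_trans (cT t).
elim: (cT s) => [x y [i xy]|x|x y z _ xy _ yz].
- by apply: rt_step; exists i; tauto.
- exact: rt_refl.
- exact: rt_trans yz xy.
Qed.

Lemma hom_adjacent (sigma : modal_signature) (T M : LTS sigma) (h : T -> M)
    (s t : T) :
  is_hom h -> adjacent s t -> adjacent (h s) (h t).
Proof. by case=> _ hR _ [i [|] /hR st]; exists i; tauto. Qed.

Lemma hom_reachable (sigma : modal_signature) (T M : LTS sigma) (h : T -> M)
    (s t : T) :
  is_hom h -> clos_refl_trans T (@adjacent sigma T) s t ->
  clos_refl_trans M (@adjacent sigma M) (h s) (h t).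
Proof.
move=> hh; elim=> [x y /(hom_adjacent hh)|x|x y z _ xy _ yz].
- exact: rt_step.
- exact: rt_refl.
- exact: rt_trans xy yz.
Qed.

(** * Equivalent assignments *)

(** When every variable already names the current state, rebinding one to it changes nothing; this
    lets open formulas be closed into sentences. *)
Lemma sat_foldr_Down_const (sigma : modal_signature) (M : LTS sigma)
    (xs : seq nat) (s : M) (phi : formula sigma) :
  sat (fun=> s) s (foldr (@Down sigma) phi xs) <-> sat (fun=> s) s phi.
Proof.
elim: xs => //= x xs IH; apply: iff_trans IH.
by apply: sat_ext => y _; rewrite /update; case: ifP.
Qed.

Lemma sentence_foldr_Down (sigma : modal_signature) (phi : formula sigma) :
  sentence (foldr (@Down sigma) phi (free_vars phi)).
Proof.
suff H xs : free_vars (foldr (@Down sigma) phi xs) =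
    [seq y <- free_vars phi | y \notin xs].
  rewrite /sentence H; apply/eqP; rewrite -(negbK (_ == _)) -has_filter.
  by apply/hasPn => y ->.
elim: xs => [|x xs IH] /=; first by rewrite filter_predT.
rewrite IH -filter_predI; apply: eq_filter => y /=.
by rewrite inE negb_or.
Qed.

Lemma sat_foldr_And (sigma : modal_signature) (M : LTS sigma) (g : nat -> M)
    (s : M) (X : eqType) (F : X -> formula sigma) (xs : seq X) :
  sat g s (foldr (fun x => And (F x)) Top xs) <->
  {in xs, forall x, sat g s (F x)}.
Proof.
elim: xs => [|x xs IH] /=; first by split.
rewrite IH; split=> [[Fx Fxs] y|Fxs].
  by rewrite inE => /predU1P[->//|]; exact: Fxs.
by split=> [|y y_xs]; apply: Fxs; rewrite inE ?eqxx ?y_xs ?orbT.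
Qed.

Section EquivalentAssignments.
Variables (sigma : modal_signature) (M N : LTS sigma).

Definition same_theory (g : nat -> M) (s : M) (g' : nat -> N) (s' : N) : Prop :=
  forall phi : formula sigma, sat g s phi <-> sat g' s' phi.

Definition same_assignment_theory (g : nat -> M) (g' : nat -> N) : Prop :=
  forall x, same_theory g (g x) g' (g' x).

Lemma same_theory_const :
  (forall phi : formula sigma, sentence phi -> models M phi <-> models N phi) ->
  same_assignment_theory (fun=> point M) (fun=> point N).
Proof.
move=> MN _ phi.
rewrite -(sat_foldr_Down_const (free_vars phi) (point M)).
rewrite -(sat_foldr_Down_const (free_vars phi) (point N)).
have sphi := sentence_foldr_Down phi.
by rewrite -!(models_sentence _ sphi); exact: MN.
Qed.

Lemma same_theory_assignment g s g' s' :
  same_theory g s g' s' -> same_assignment_theory g g'.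
Proof. by move=> E x phi; exact: (E (At x phi)). Qed.

(** Equalities, letters and edges between named states are themselves expressible, so matching equal
    names gives a partial isomorphism. *)
Lemma same_theory_rel g g' :
  same_assignment_theory g g' ->
  [/\ forall x y, g x = g y <-> g' x = g' y,
      forall p x, val_ M p (g x) <-> val_ N p (g' x) &
      forall i x y, rel_ M i (g x) (g y) <-> rel_ N i (g' x) (g' y)].
Proof.
move=> E; split=> [x y|p x|i x y].
- exact: (E y (WVar x)).
- exact: (E x (Letter p)).
- have /= H := E x (Dia i (WVar y)).
  split=> xy.
  + by have [|t [xt ->]//] := iffLR H; exists (g y).
  + by have [|t [xt ->]//] := iffRL H; exists (g' y).
Qed.

(* Hennessy-Milner argument: if every one of the finitely many candidates [t']
   were separated from [t] by some formula, so would be their conjunction. *)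
Lemma same_theory_step (A' : set N) (D : formula sigma -> formula sigma)
    g g' s s' x t :
  finite_set A' -> same_theory g s g' s' ->
  (forall phi, sat (update g x t) t phi -> sat g s (D (Down x phi))) ->
  (forall phi, sat g' s' (D (Down x phi)) ->
     exists2 t', A' t' & sat (update g' x t') t' phi) ->
  exists t', same_theory (update g x t) t (update g' x t') t'.
Proof.
move=> /(@finite_seqP {classic N})[l lE] E Dt DA'; apply: contrapT => noE.
have sep t' : exists phi, sat (update g x t) t phi /\
    ~ sat (update g' x t') t' phi.
  have : ~ same_theory (update g x t) t (update g' x t') t'.
    by move=> Et'; apply: noE; exists t'.
  move=> /existsNP[phi nphi].
  (* The separating formula has to hold on the side of [M]; if it does not, its negation is
     taken. *)
  have [tphi|tNphi] := pselect (sat (update g x t) t phi).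
    by exists phi; split=> // t'phi; apply: nphi.
  by exists (Neg phi); split=> //= t'Nphi; apply: nphi; tauto.
have [F FP] := choice sep.
have /Dt/E/DA'[t' A't'] : sat (update g x t) t
    (foldr (fun t' : {classic N} => And (F t')) Top l).
  by apply/(iffRL (sat_foldr_And _ _ _ _)) => t' _; have [] := FP t'.
move=> /(iffLR (sat_foldr_And _ _ _ _))/(_ t') t'F; have [_] := FP t'; apply; apply: t'F.
by move: A't'; rewrite lE.
Qed.

(** The candidates for [t'] are the successors or the predecessors of [s'], finite in number; edges
    into [s] are where the backward modality is needed. *)
Lemma same_theory_adjacent g g' s s' x t :
  degree_finite N -> same_theory g s g' s' -> adjacent s t ->
  exists t', same_theory (update g x t) t (update g' x t') t'.
Proof.
move=> dN E [i [st|ts]]; have [fS fP] := dN s'.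
- apply: (same_theory_step (D := Dia i) fS E) => phi /=; first by exists t.
  by move=> [t' [s't' phit']]; exists t' => //; exists i.
- apply: (same_theory_step (D := BDia i) fP E) => phi /=; first by exists t.
  by move=> [t' [s't' phit']]; exists t' => //; exists i.
Qed.

(* Variable [0] keeps naming the point and the variables from [n] on are
   free for further extensions. *)
Definition extends (g : nat -> M) (g' : nat -> N) n g2 g2' n2 : Prop :=
  [/\ 0 < n2, n <= n2, same_assignment_theory g2 g2',
      g2 0 = g 0 /\ g2' 0 = g' 0 & forall x, x < n -> g2 x = g x].

(** Induction along a path from the point: every state on the way also receives a name, from which
    the next one is reached. *)
Lemma extends_reachable g g' n (t : M) :
  degree_finite N -> 0 < n -> same_assignment_theory g g' ->
  clos_refl_trans M (@adjacent sigma M) (g 0) t ->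
  exists g2 g2' n2, extends g g' n g2 g2' n2 /\ exists2 x, x < n2 & g2 x = t.
Proof.
move=> dN n0 E gt; elim: {t gt}(clos_rt_rtn1 _ _ _ _ gt) => [|u t ut _].
  by exists g, g', n; split=> //; exists 0.
move=> [g2 [g2' [n2 [[n20 nn2 E2 [g20 g2'0] g2g] [x xn2 xu]]]]].
rewrite -xu in ut; have [t' Et'] := same_theory_adjacent n2 dN (E2 x) ut.
(* The variable [n2] is fresh, so no earlier name is overwritten. *)
exists (update g2 n2 t), (update g2' n2 t'), n2.+1; split; last first.
  by exists n2 => //; rewrite /update eqxx.
split=> //; first exact: leqW.
- exact: same_theory_assignment Et'.
- by rewrite /update (ltn_eqF n20).
- move=> y yn; rewrite /update (ltn_eqF (leq_trans yn nn2)); exact: g2g.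
Qed.

Lemma same_theory_cover (l : seq {classic M}) :
  degree_finite N ->
  same_assignment_theory (fun=> point M) (fun=> point N) ->
  (forall t, t \in l ->
     clos_refl_trans M (@adjacent sigma M) (point M) t) ->
  exists g g', [/\ same_assignment_theory g g', g 0 = point M, g' 0 = point N
    & forall t, t \in l -> exists x, g x = t].
Proof.
move=> dN E0 lP.
suff [g [g' [n [[_ _ E [g0 g'0] _] gl]]]] : exists g g' n,
    extends (fun=> point M) (fun=> point N) 1 g g' n /\
    forall t, t \in l -> exists2 x, x < n & g x = t.
  by exists g, g'; split=> // t /gl[x _ <-]; exists x.
elim: l lP => [|t l IH] lP.
  by exists (fun=> point M), (fun=> point N), 1.
have [|g [g' [n [[n0 _ E [g0 g'0] _] gl]]]] := IH.
  by move=> u ul; apply: lP; rewrite inE ul orbT.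
have [|g2 [g2' [n2 [[n20 nn2 E2 [g20 g2'0] g2g] [x xn2 xt]]]]] :=
    @extends_reachable g g' n t dN n0 E.
  by rewrite g0; apply: lP; rewrite inE eqxx.
exists g2, g2', n2; split.
  split=> //; first by rewrite g20 g2'0.
  by case=> // _; rewrite g20.
move=> u; rewrite inE => /predU1P[->|/gl[y yn <-]]; first by exists x.
by exists y; [exact: leq_trans yn nn2|exact: g2g].
Qed.

(** Once all values of homomorphisms [T -> M] are named, composing with the matching [g x] to [g' x]
    is an injection into the homomorphisms [T -> N]. *)
Lemma leq_hom_count_same_theory (T : LTS sigma) :
  degree_finite M -> degree_finite N -> finite_connected T ->
  same_assignment_theory (fun=> point M) (fun=> point N) ->
  hom_count T M <= hom_count T N.
Proof.
move=> dM dN fcT E0; have [fT cT] := fcT.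
pose im := \bigcup_(s in [set: T]) [set h s | h in [set h : T -> M | is_hom h]].
have /(@finite_seqP {classic M})[l lE] : finite_set im.
  by apply: bigcup_finite => // s _; exact: finite_hom_images.
have lP (t : {classic M}) : t \in l <-> im t by rewrite lE.
have [|g [g' [E g0 g'0 gP]]] := same_theory_cover (l := l) dN E0.
  move=> _ /lP[s _ [h hh <-]]; have [_ _ <-] := hh.
  exact/hom_reachable/cT.
have [Eeq Eval Erel] := same_theory_rel E.
have [f fP] : exists f : M -> N, forall x, f (g x) = g' x.
  (* Two names of one state of [M] name one state of [N], so [f] is well defined; unnamed states get
     the default value [point N]. *)
  have /choice[f fP] : forall u, exists u', forall x, g x = u -> g' x = u'.
    move=> u; have [[x <-]|nx] := pselect (exists x, g x = u).
      by exists (g' x) => y; exact: (iffLR (Eeq _ _)).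
    by exists (point N) => x xu; case: nx; exists x.
  by exists f => x; rewrite -(fP (g x) x).
have ghP (h : T -> M) s : is_hom h -> exists x, g x = h s.
  by move=> hh; apply: gP; apply/lP; exists s => //; exists h.
apply: (leq_card_fset_set_in (f := fun h : {classic (T -> M)} =>
    (f \o h : {classic (T -> N)}))); [exact: finite_homs..| |].
- move=> h k /set_mem hh /set_mem kh /= fhk.
  apply: (functional_extensionality_dep (A := T)) => s.
  have [x xh] := ghP h s hh; have [y yk] := ghP k s kh.
  have /= := congr1 (fun w : T -> N => w s) fhk.
  by rewrite /= -xh -yk !fP => /Eeq.
- move=> h hh; have [hV hR hpt] := hh; split=> [p s|i s t|] /=.
  + by have [x xh] := ghP h s hh; move=> /hV; rewrite -xh fP => /Eval.
  + have [x xh] := ghP h s hh; have [y yh] := ghP h t hh.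
    by move=> /hR; rewrite -xh -yh !fP => /Erel.
  + by rewrite hpt -g0 fP.
Qed.

End EquivalentAssignments.

Lemma hom_count_same_theory (sigma : modal_signature) (M N T : LTS sigma) :
  degree_finite M -> degree_finite N -> finite_connected T ->
  (forall phi : formula sigma, sentence phi -> models M phi <-> models N phi) ->
  hom_count T M = hom_count T N.
Proof.
move=> dM dN fcT MN; apply/eqP; rewrite eqn_leq.
apply/andP; split; apply: leq_hom_count_same_theory => //.
  exact: same_theory_const.
by apply: same_theory_const => phi /MN ->.
Qed.

(** * Counting injective homomorphisms *)

Lemma card_fset_set_partition (U : choiceType) (J : finType) (p : U -> J)
    (A : set U) :
  finite_set A ->
  #|` fset_set A| = \sum_(j : J) #|` fset_set (A `&` [set x | p x = j])|.
Proof.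
move=> fA; rewrite card_fset_sum1 (partition_big p predT) //=.
apply: eq_bigr => j _; rewrite big_fset_condE -card_fset_sum1.
congr #|` _ |; apply/fsetP => x.
rewrite !inE in_fset_set ?in_fset_set//; last exact: finite_setIl.
apply/andP/idP => [[/set_mem Ax /eqP xj]|/set_mem[Ax /= xj]].
  by apply/mem_set; split.
by split; [exact/mem_set|exact/eqP].
Qed.

Section KernelRepresentative.
Variable K : finType.

(* A function on [K] determines and is determined up to renaming of its values
   by the map sending [t] to the first element of its kernel class. *)
Definition ker_repr (X : Type) (h : K -> X) : {ffun K -> K} :=
  [ffun t => odflt t [pick u | `[< h u = h t >]]].

Lemma ker_reprK (X : Type) (h : K -> X) t : h (ker_repr h t) = h t.
Proof. by rewrite ffunE; case: pickP => [u /asboolP|]. Qed.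

Lemma ker_reprP (X : Type) (h : K -> X) u t :
  ker_repr h u = ker_repr h t <-> h u = h t.
Proof.
split=> ut; first by rewrite -(ker_reprK h u) ut ker_reprK.
(* Both sides now search the same class; only the defaults differ, and they never occur because [t]
   lies in the class. *)
by rewrite !ffunE ut; case: pickP => // /(_ t)/asboolP.
Qed.

Lemma eq_ker_repr (X Y : Type) (h : K -> X) (k : K -> Y) :
  (forall u t, h u = h t <-> k u = k t) -> ker_repr h = ker_repr k.
Proof.
move=> hk; apply/ffunP => t; rewrite !ffunE; congr odflt.
by apply: eq_pick => u; apply/asboolP/asboolP => /hk.
Qed.

(** Hence a map not fixed by [ker_repr] represents the kernel of no function. *)
Lemma ker_repr_idem (X : Type) (h : K -> X) :
  ker_repr (ker_repr h) = ker_repr h.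
Proof. exact: eq_ker_repr (ker_reprP h). Qed.

Lemma ker_repr_inj (X : Type) (h : K -> X) :
  injective h <-> ker_repr h = [ffun t => t].
Proof.
split=> [hI|hE u t]; last by move=> /ker_reprP; rewrite hE !ffunE.
by apply/ffunP => t; apply: hI; rewrite ker_reprK ffunE.
Qed.

End KernelRepresentative.

Definition inj_homs (sigma : modal_signature) (T M : LTS sigma) :
    set {classic (T -> M)} :=
  [set h | is_hom h /\ injective h].
Arguments inj_homs {sigma} T M.

Lemma finite_inj_homs (sigma : modal_signature) (T M : LTS sigma) :
  finite_connected T -> degree_finite M -> finite_set (inj_homs T M).
Proof.
by move=> fcT dM; apply: sub_finite_set (finite_homs fcT dM) => h [].
Qed.

Section Quotient.
Variables (sigma : modal_signature) (K : finType).
Variables (v : prop_letter sigma -> K -> Prop).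
Variables (rl : action sigma -> K -> K -> Prop) (c : K).
Let T : LTS sigma := MkLTS v rl c.
(** The hypothesis [rE] makes [r] idempotent: it selects one representative in each class of its
    kernel. *)
Variables (r : {ffun K -> K}) (rE : ker_repr r = r).

Let rK t : r (r t) == r t.
Proof. by have /eqP := ker_reprK r t; rewrite rE. Qed.

Definition quotient_proj (t : K) : {t : K | r t == t} := exist _ (r t) (rK t).
Local Notation proj := quotient_proj.

(** The carrier consists of the representatives, so it is again a [finType]; the facts are the
    images of those of [T] and no others. *)
Definition quotient : LTS sigma :=
  @MkLTS sigma {t : K | r t == t}
    (fun p u => exists2 t, proj t = u & v p t)
    (fun i u w => exists s t, [/\ proj s = u, proj t = w & rl i s t])
    (proj c).

Let projK (u : quotient) : proj (val u) = u.
Proof. by apply: val_inj; case: u => u /= /eqP. Qed.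

Let proj_eq s t : proj s = proj t <-> r s = r t.
Proof. by split=> [[]//|st]; apply: val_inj. Qed.

Lemma quotient_proj_hom : @is_hom sigma T quotient proj.
Proof. by split=> [p s|i s t|] //= st; [exists s|exists s, t]. Qed.

Lemma connected_quotient : connected T -> connected quotient.
Proof.
move=> cT s t; rewrite -(projK s) -(projK t).
exact: hom_reachable quotient_proj_hom (cT _ _).
Qed.

Lemma finite_connected_quotient : connected T -> finite_connected quotient.
Proof.
by move=> cT; split; [exact: finite_finset|exact: connected_quotient].
Qed.

(** Precomposition with [proj] is a bijection from the injective homomorphisms on the quotient to
    the homomorphisms with kernel representative [r]. *)
Lemma card_ker_fiber (M : LTS sigma) :
  degree_finite M -> connected T ->
  #|` fset_set (homs T M `&` [set h | @ker_repr K M h = r])| =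
  #|` fset_set (inj_homs quotient M)|.
Proof.
move=> dM cT.
have fT : finite_set (homs T M `&` [set h | @ker_repr K M h = r]).
  apply: finite_setIl; apply: finite_homs => //.
  by split=> //; exact: finite_finset.
have fQ := finite_inj_homs (finite_connected_quotient cT) dM.
apply/(fcard_eq fT fQ).
pose F (k : {classic (quotient -> M)}) : {classic (T -> M)} := k \o proj.
suff -> : homs T M `&` [set h | @ker_repr K M h = r] =
    F @` inj_homs quotient M.
  apply: inj_card_eq => k k' _ _ kk'.
  apply: (functional_extensionality_dep (A := quotient)) => u.
  rewrite -(projK u).
  exact: (congr1 (fun w : T -> M => w (val u)) kk').
apply/seteqP; split=> [h [[hV hR hpt] /= hr]|_ [k [[kV kR kpt] kI] <-]].
  have hrK t : h (r t) = h t by rewrite -{1}hr ker_reprK.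
  have hrI s t : h s = h t -> r s = r t by rewrite -hr => /ker_reprP.
  (* The preimage of [h] is its restriction to the representatives. *)
  exists (fun u : quotient => h (val u)); last first.
    by apply: (functional_extensionality_dep (A := T)) => t /=; exact: hrK.
  split; first split=> [p _ [t <-] /hV|i _ _ [s [t [<- <-]]] /hR|] //=.
  - by rewrite hrK.
  - by rewrite !hrK.
  - by rewrite hrK.
  move=> u w /= huw; rewrite -(projK u) -(projK w).
  exact/proj_eq/hrI.
split.
  have [pV pR _] := quotient_proj_hom.
  by split=> [p t /pV/kV|i s t /pR/kR|].
rewrite /= -[RHS]rE; apply: eq_ker_repr => u t /=.
by rewrite -proj_eq; split=> [/kI//|ut]; rewrite /F /= ut.
Qed.

End Quotient.

Lemma card_quotient_lt (K : finType) (r : {ffun K -> K}) :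
  r != [ffun t => t] -> #|{: {t : K | r t == t}}| < #|K|.
Proof.
move=> rN; rewrite card_sig; apply: proper_card; apply/properP; split.
  exact: subset_predT.
apply: contrapT => noN; move/eqP: rN; apply; apply/ffunP => t; rewrite ffunE.
by apply/eqP/negPn/negP => rt; apply: noN; exists t; rewrite ?inE.
Qed.

(** Strong induction on the size of [K]: the hom count is a sum over kernels, the identity
    contributes the injective homomorphisms, and the other terms agree, so they cancel. *)
Lemma card_inj_homs_eq (sigma : modal_signature) (M N : LTS sigma) :
  degree_finite M -> degree_finite N ->
  hom_vector (@finite_connected sigma) M =
    hom_vector (@finite_connected sigma) N ->
  forall (K : finType) v rl (c : K), let T := @MkLTS sigma K v rl c in
  connected T ->
  #|` fset_set (inj_homs T M)| = #|` fset_set (inj_homs T N)|.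
Proof.
move=> dM dN MN K.
have [n] := ubnP #|K|; elim: n K => // n IH K /ltnSE Kn v rl c T cT.
have fcT : finite_connected T by split=> //; exact: finite_finset.
have : hom_count T M = hom_count T N.
  exact: (congr1 (fun w => w (exist _ T fcT)) MN).
pose kr (P : LTS sigma) (h : {classic (T -> P)}) := @ker_repr K P h.
rewrite /hom_count (card_fset_set_partition (kr M) (finite_homs fcT dM)).
rewrite (card_fset_set_partition (kr N) (finite_homs fcT dN)) /kr.
rewrite (bigD1 [ffun t => t])//= [in RHS](bigD1 [ffun t => t])//=.
have idE (P : LTS sigma) :
    homs T P `&` [set h | @ker_repr K P h = [ffun t => t]] = inj_homs T P.
  by apply/seteqP; split=> h [hh] /= /ker_repr_inj.
rewrite !idE; set sM := (\sum_(_ | _) _) => E.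
suff sE : sM = \sum_(r : {ffun K -> K} | r != [ffun t => t])
    #|` fset_set (homs T N `&` [set h | @ker_repr K N h = r])|.
  by move/eqP: E; rewrite sE eqn_add2r => /eqP.
apply: eq_bigr => r rN.
(* Either [r] is a genuine kernel representative, whose quotient is smaller than [K], or its fiber
   is empty. *)
have [rE|rNE] := eqVneq (ker_repr r) r.
  rewrite !(card_ker_fiber rE)//; apply: IH; last exact: connected_quotient.
  exact: leq_trans (card_quotient_lt rN) Kn.
have none (P : LTS sigma) : homs T P `&` [set h | @ker_repr K P h = r] = set0.
  rewrite -subset0 => h [_ /= hr]; move: rNE; rewrite -hr.
  by rewrite ker_repr_idem eqxx.
by rewrite (none M) (none N) !fset_set0 !cardfs0.
Qed.

Lemma inj_hom_transfer (sigma : modal_signature) (M N : LTS sigma) :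
  degree_finite M -> degree_finite N ->
  hom_vector (@finite_connected sigma) M =
    hom_vector (@finite_connected sigma) N ->
  forall (K : finType) v rl (c : K), let T := @MkLTS sigma K v rl c in
  connected T ->
  (exists h : T -> M, is_hom h /\ injective h) ->
  exists h : T -> N, is_hom h /\ injective h.
Proof.
move=> dM dN MN K v rl c T cT [h hP].
have fcT : finite_connected T by split=> //; exact: finite_finset.
have fM := finite_inj_homs fcT dM; have fN := finite_inj_homs fcT dN.
have : 0 < #|` fset_set (inj_homs T N)|.
  rewrite -(card_inj_homs_eq dM dN MN cT) cardfs_gt0.
  apply/fset0Pn; exists (h : {classic (T -> M)}).
  by rewrite in_fset_set//; exact/mem_set.
rewrite cardfs_gt0 => /fset0Pn[k]; rewrite in_fset_set// => /set_mem kP.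
by exists k.
Qed.

(** * Balls around the point *)

Fixpoint ball (sigma : modal_signature) (M : LTS sigma) (n : nat) : set M :=
  if n is m.+1 then
    @ball sigma M m `|` \bigcup_(s in @ball sigma M m) [set t | adjacent s t]
  else [set point M].
Arguments ball {sigma} M n.

Definition induced (sigma : modal_signature) (M : LTS sigma) (K : Type)
    (f : K -> M) (c : K) : LTS sigma :=
  MkLTS (fun p s => val_ M p (f s)) (fun i s t => rel_ M i (f s) (f t)) c.

Section Ball.
Variables (sigma : modal_signature) (M : LTS sigma).

Lemma subset_ball m n : m <= n -> ball M m `<=` ball M n.
Proof.
move=> /subnKC<-; elim: (n - m) => [|k IH]; first by rewrite addn0.
by rewrite addnS => x /IH mx; left.
Qed.

Lemma ball_adjacent n s t : ball M n s -> adjacent s t -> ball M n.+1 t.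
Proof. by move=> ns st; right; exists s. Qed.

Lemma finite_ball n : degree_finite M -> finite_set (ball M n).
Proof.
move=> dM; elim: n => [|n IH] /=; first exact: finite_set1.
rewrite finite_setU; split=> //; apply: bigcup_finite => // s _.
have := dM s; rewrite -finite_setU; apply: sub_finite_set => t [i [|] st];
  by [left; exists i|right; exists i].
Qed.

Definition parametrizes_ball n (K : Type) (f : K -> M) (c : K) : Prop :=
  [/\ injective f, forall x, ball M n x <-> exists a, f a = x & f c = point M].

(** This presents the ball over a [finType], the kind of carrier for which injective homomorphisms
    were counted. *)
Lemma ball_parametrization n :
  degree_finite M ->
  exists (K : finType) (f : K -> M) (c : K), parametrizes_ball n f c.
Proof.
move=> /(@finite_ball n)/(@finite_seqP {classic M})[l lE].
have ptl : (point M : {classic M}) \in l.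
  have : ball M n (point M) by exact: (@subset_ball 0).
  by rewrite lE.
exists (seq_sub l), (@ssval _ l), (SeqSub ptl); split=> //.
  exact: val_inj.
move=> x; rewrite lE; split=> [xl|[a <-]]; last exact: ssvalP.
by exists (SeqSub xl).
Qed.

End Ball.

Section ParametrizedBall.
Variables (sigma : modal_signature) (M : LTS sigma).
Variables (n : nat) (K : Type) (f : K -> M) (c : K).
Hypothesis fP : parametrizes_ball n f c.

Lemma connected_ball : connected (induced f c).
Proof.
have [fI fB fc] := fP; apply: connected_of_point => a.
have : ball M n (f a) by apply/fB; exists a.
(* Only the radius in the membership of [f a] is generalized to [k <= n]; [f] still parametrizes the
   ball of radius [n]. *)
have : n <= n by []; elim: {1 3}n a => [|k IH] a kn.
  by move=> fa; have -> : a = c; [apply: fI; rewrite fc|exact: rt_refl].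
move=> [/IH|[s ks sa]]; first by apply; exact: ltnW.
have /fB[b bs] := subset_ball (ltnW kn) ks; rewrite -bs in ks sa.
by apply: rt_trans (IH b (ltnW kn) ks) _; exact: rt_step.
Qed.

(** Homomorphisms fix the point and preserve adjacency, so they do not increase the distance to the
    point. *)
Lemma hom_ball (N : LTS sigma) (h : induced f c -> N) :
  is_hom h -> forall a, ball N n (h a).
Proof.
move=> hh a; have [fI fB fc] := fP.
have : ball M n (f a) by apply/fB; exists a.
have : n <= n by []; elim: {1 3 4}n a => [|k IH] a kn.
  have [_ _ hpt] := hh.
  by move=> fa; have -> : a = c; [apply: fI; rewrite fc|exact: hpt].
move=> [/IH|[s ks sa]]; first by left; auto using ltnW.
have /fB[b bs] := subset_ball (ltnW kn) ks; rewrite -bs in ks sa.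
by apply: ball_adjacent (IH b (ltnW kn) ks) _; exact: hom_adjacent hh sa.
Qed.

End ParametrizedBall.

(** Taking the order of the induced permutation of [K * K] gives one positive exponent that works
    for both elements. *)
Lemma iter_pair_id (K : finType) (q : K -> K) (a b : K) :
  injective q -> exists m, iter m.+1 q a = a /\ iter m.+1 q b = b.
Proof.
move=> qI; pose Q (x : K * K) := (q x.1, q x.2).
have QI : injective Q by move=> [x y] [z w] [/qI-> /qI->].
have iterQ m x y : iter m Q (x, y) = (iter m q x, iter m q y).
  by elim: m => //= m ->.
exists (order Q (a, b)).-1; rewrite prednK ?order_gt0//.
by have := iter_order QI (a, b); rewrite iterQ => -[].
Qed.

(* Composing the two embeddings gives a permutation of the finite ball of [M];
   as some iterate of it is the identity, [h] also reflects facts. *)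
Lemma ball_iso (sigma : modal_signature) (M N : LTS sigma) (n : nat)
    (K K' : finType) (f : K -> M) (c : K) (f' : K' -> N) (c' : K')
    (h : induced f c -> N) (h' : induced f' c' -> M) :
  parametrizes_ball n f c -> parametrizes_ball n f' c' ->
  is_hom h -> injective h -> is_hom h' -> injective h' ->
  [/\ parametrizes_ball n (h : K -> N) c,
      forall p a, val_ M p (f a) <-> val_ N p (h a) &
      forall i a b, rel_ M i (f a) (f b) <-> rel_ N i (h a) (h b)].
Proof.
move=> fP f'P hh hI hh' h'I; have [fI fB fc] := fP; have [f'I f'B f'c] := f'P.
have /choice[q1 q1E] : forall a : K, exists b : K', f' b = h a.
  by move=> a; apply/f'B; exact: (hom_ball fP hh a).
have /choice[q2 q2E] : forall b : K', exists a : K, f a = h' b.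
  by move=> b; apply/fB; exact: (hom_ball f'P hh' b).
have q1I : injective q1 by move=> a b ab; apply: hI; rewrite -!q1E ab.
have q2I : injective q2 by move=> a b ab; apply: h'I; rewrite -!q2E ab.
have [hV hR hpt] := hh; have [h'V h'R h'pt] := hh'.
pose q := q2 \o q1; have qI : injective q := inj_comp q2I q1I.
have qV p a : val_ N p (h a) -> val_ M p (f (q a)).
  by rewrite q2E -q1E; exact: h'V.
have qR i a b : rel_ N i (h a) (h b) -> rel_ M i (f (q a)) (f (q b)).
  by rewrite !q2E -!q1E; exact: h'R.
split=> [|p a|i a b].
- split=> // x; split=> [/f'B[b <-]|[a <-]]; last exact: (hom_ball fP hh a).
  (* An injective self-map of the finite [K'] is onto, so [h] reaches the whole ball of [N]. *)
  have /codomP[b0 ->] := injF_onto (inj_comp q1I q2I) b.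
  by exists (q2 b0); rewrite -q1E.
- split=> [|ha]; first exact: hV.
  (* The fact is carried back and forth between [N] and [M], moving [a] by [q] each round, until it
     returns to [a] in [M]. *)
  have [m [am _]] := iter_pair_id a a qI; rewrite -{1}am.
  by elim: m {am} => [|m IH]; [exact: qV|apply: qV; exact: hV].
- split=> [|hab]; first exact: hR.
  have [m [am bm]] := iter_pair_id a b qI; rewrite -{1}am -{1}bm.
  by elim: m {am bm} => [|m IH]; [exact: qR|apply: qR; exact: hR].
Qed.

(** * Locality of the logic *)

Fixpoint modal_depth (sigma : modal_signature) (phi : formula sigma) : nat :=
  match phi with
  | Top | Letter _ | WVar _ => 0
  | Neg psi | Down _ psi | At _ psi => modal_depth psi
  | And psi chi => maxn (modal_depth psi) (modal_depth chi)
  | Dia _ psi | BDia _ psi => (modal_depth psi).+1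
  end.

(** The invariant is that the current state and all named states lie in the balls of radius [m]. A
    modality trades one unit of depth for one of radius; named states must be bounded too, because
    [At] jumps to them. *)
Lemma sat_ball_iso (sigma : modal_signature) (M N : LTS sigma) (n : nat)
    (K : Type) (f : K -> M) (f' : K -> N) (c : K) :
  parametrizes_ball n f c -> parametrizes_ball n f' c ->
  (forall p a, val_ M p (f a) <-> val_ N p (f' a)) ->
  (forall i a b, rel_ M i (f a) (f b) <-> rel_ N i (f' a) (f' b)) ->
  forall (phi : formula sigma) m (g : nat -> K) (a : K),
  m + modal_depth phi <= n ->
  (forall x, ball M m (f (g x)) /\ ball N m (f' (g x))) ->
  ball M m (f a) /\ ball N m (f' a) ->
  sat (f \o g) (f a) phi <-> sat (f' \o g) (f' a) phi.
Proof.
move=> [fI fB fc] [f'I f'B f'c] fV fR.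
have upd (X : Type) (k : K -> X) g x a :
    k \o update g x a = update (k \o g) x (k a).
  by apply/funext => y; rewrite /update /=; case: ifP.
have mono m (x : K) : ball M m (f x) /\ ball N m (f' x) ->
    ball M m.+1 (f x) /\ ball N m.+1 (f' x).
  by case; split; left.
have step m i a b : ball M m (f a) /\ ball N m (f' a) ->
    rel_ M i (f a) (f b) \/ rel_ M i (f b) (f a) ->
    ball M m.+1 (f b) /\ ball N m.+1 (f' b).
  move=> [Ma Na] ab; split; first by apply: ball_adjacent Ma _; exists i.
  by apply: ball_adjacent Na _; exists i; rewrite -!fR.
have inM m i a t : m < n -> ball M m (f a) ->
    rel_ M i (f a) t \/ rel_ M i t (f a) -> exists b, f b = t.
  move=> mn Ma at_; apply/fB; apply: (subset_ball mn).
  by apply: ball_adjacent Ma _; exists i.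
have inN m i a t : m < n -> ball N m (f' a) ->
    rel_ N i (f' a) t \/ rel_ N i t (f' a) -> exists b, f' b = t.
  move=> mn Na at_; apply/f'B; apply: (subset_ball mn).
  by apply: ball_adjacent Na _; exists i.
elim=> [|p|x|psi IH|psi IH1 chi IH2|i psi IH|i psi IH|x psi IH|x psi IH] m g a
  //= mn gB aB.
- by split=> [/fI->|/f'I->].
- by rewrite (IH m g a).
- rewrite (IH1 m g a)// ?(IH2 m g a)//; apply: leq_trans mn;
    by rewrite leq_add2l ?leq_maxl ?leq_maxr.
- rewrite addnS -addSn in mn.
  have mn' : m < n by apply: leq_trans mn; rewrite addSn ltnS leq_addr.
  split=> -[t [at_ tpsi]].
    have [b bt] := inM m i a t mn' aB.1 (or_introl at_); subst t.
    exists (f' b); rewrite -fR; split=> //; apply/(IH m.+1) => //.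
    + by move=> x; exact: mono.
    + by apply: step aB _; left; exact: at_.
  have [b bt] := inN m i a t mn' aB.2 (or_introl at_); subst t.
  move/fR: at_ => at_; exists (f b); split=> //; apply/(IH m.+1) => //.
  + by move=> x; exact: mono.
  + by apply: step aB _; left; exact: at_.
- rewrite addnS -addSn in mn.
  have mn' : m < n by apply: leq_trans mn; rewrite addSn ltnS leq_addr.
  split=> -[t [at_ tpsi]].
    have [b bt] := inM m i a t mn' aB.1 (or_intror at_); subst t.
    exists (f' b); rewrite -fR; split=> //; apply/(IH m.+1) => //.
    + by move=> x; exact: mono.
    + by apply: step aB _; right; exact: at_.
  have [b bt] := inN m i a t mn' aB.2 (or_intror at_); subst t.
  move/fR: at_ => at_; exists (f b); split=> //; apply/(IH m.+1) => //.
  + by move=> x; exact: mono.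
  + by apply: step aB _; right; exact: at_.
- rewrite -!upd; apply: (IH m) => // y.
  by rewrite /update; case: ifP.
- exact: (IH m).
Qed.

Lemma models_hom_vector (sigma : modal_signature) (M N : LTS sigma) :
  degree_finite M -> degree_finite N ->
  hom_vector (@finite_connected sigma) M =
    hom_vector (@finite_connected sigma) N ->
  forall phi : formula sigma, sentence phi -> (models M phi <-> models N phi).
Proof.
move=> dM dN MN phi sphi; pose n := modal_depth phi.
have [K [f [c fP]]] := ball_parametrization n dM.
have [K' [f' [c' f'P]]] := ball_parametrization n dN.
(* The inclusion of a ball is an injective homomorphism, and equal counts yield one into the other
   structure. *)
have inc (P : LTS sigma) (L : Type) (k : L -> P) d :
    parametrizes_ball n k d ->
    exists h : induced k d -> P, is_hom h /\ injective h.
  by move=> [kI _ kd]; exists k; split=> //; split.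
have [h [hh hI]] :=
  inj_hom_transfer dM dN MN (connected_ball fP) (inc _ _ _ _ fP).
have [h' [hh' h'I]] :=
  inj_hom_transfer dN dM (esym MN) (connected_ball f'P) (inc _ _ _ _ f'P).
have [hP hV hR] := ball_iso fP f'P hh hI hh' h'I.
have [_ _ fc] := fP; have [_ _ hc] := hP.
(* A sentence may be evaluated with all variables naming the point, which meets the locality
   invariant at radius [0]. *)
rewrite (models_sentence (f \o fun=> c) sphi).
rewrite (models_sentence ((h : K -> N) \o fun=> c) sphi) -fc -hc.
by apply: (sat_ball_iso fP hP hV hR (m := 0)) => //; rewrite /= fc hc.
Qed.

Theorem theorem5p12 (sigma : modal_signature) (M N : LTS sigma)
    (hM : degree_finite M) (hN : degree_finite N) :
  (forall phi : formula sigma,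
      sentence phi -> (models M phi <-> models N phi)) <->
  hom_vector (@finite_connected sigma) M = hom_vector (@finite_connected sigma) N.
Proof.
split=> [MN|]; last exact: models_hom_vector.
by apply/funext => -[T fcT]; exact: hom_count_same_theory.
Qed.
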